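(* Let $(A_\gamma)_{\gamma\in\Gamma}$ be a family of Banach algebras (over the same scalar field $\mathbb{R}$ or $\mathbb{C}$) and let $\mathcal{U}$ be an ultrafilter on the set $\Gamma$. If the multiplications in $A_\gamma$ $(\gamma\in\Gamma)$ are equi-uniformly open, then the ultraproduct $\prod_{\gamma\in\Gamma}^{\mathcal{U}}A_\gamma$ has uniformly open multiplication.
   Context: Let $A=\big(\bigoplus_{\gamma\in\Gamma}A_\gamma\big)_{\ell_\infty(\Gamma)}$ be the Banach algebra of all tuples $(x_\gamma)_{\gamma\in\Gamma}$ with $x_\gamma\in A_\gamma$ and $\sup_\gamma\|x_\gamma\|<\infty$, with the supremum norm and coordinate-wise product, and let $J$ be its closed ideal of all tuples with $\lim_{\gamma\to\mathcal{U}}\|x_\gamma\|=0$. The (Banach-algebra) ultraproduct $\prod_{\gamma\in\Gamma}^{\mathcal{U}}A_\gamma$ is the quotient Banach algebra $A/J$. With $B(x,r)$ the open ball and $U\cdot V=\{uv\colon u\in U,v\in V\}$, multiplication in a Banach algebra $A$ is uniformly open if for every $\varepsilon>0$ there is $\delta>0$ such that $B(xy,\delta)\subseteq B(x,\varepsilon)\cdot B(y,\varepsilon)$ for all $x,y\in A$; the multiplications in $A_\gamma$ $(\gamma\in\Gamma)$ are equi-uniformly open if for every $\varepsilon>0$ one $\delta>0$ works simultaneously for all $A_\gamma$. *)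

(* Defs.v *)
From HB Require Import structures.
From mathcomp Require Import all_boot all_order all_algebra.
From mathcomp Require Import all_classical all_reals all_analysis.
From mathcomp Require Import complex.

Set Implicit Arguments.
Unset Strict Implicit.
Unset Printing Implicit Defensive.

Import Order.TTheory GRing.Theory Num.Theory.
Import numFieldNormedType.Exports.

Local Open Scope classical_set_scope.
Local Open Scope ring_scope.

Variant scalar_kind := RealScalars | ComplexScalars.

Definition scalar_field (R : realType) (s : scalar_kind) : numFieldType :=
  match s with
  | RealScalars => (R : numFieldType)
  | ComplexScalars => (R[i] : numFieldType)
  end.

(* The product is a separate operation, not a ring multiplication, because the
   ring structures of the library have a unit and Banach algebras need not. *)
HB.mixin Record CompleteNormedModule_isBanachAlgebra (K : numFieldType) A
    & CompleteNormedModule K A := {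
  bmul : A -> A -> A;
  bmulA : associative bmul;
  bmulDl : left_distributive bmul +%R;
  bmulDr : right_distributive bmul +%R;
  bscalerAl : forall (a : K) (x y : A), a *: bmul x y = bmul (a *: x) y;
  bscalerAr : forall (a : K) (x y : A), a *: bmul x y = bmul x (a *: y);
  normr_bmul : forall x y : A, `|bmul x y| <= `|x| * `|y|
}.

#[short(type="banachAlgType")]
HB.structure Definition BanachAlgebra (K : numFieldType) :=
  {A of CompleteNormedModule K A & CompleteNormedModule_isBanachAlgebra K A}.

Notation "x *b y" := (bmul x y)
  (at level 40, left associativity, format "x  *b  y") : ring_scope.

Section UniformlyOpen.
Variable K : numFieldType.

Definition bmul_set (A : banachAlgType K) (U V : set A) : set A :=
  [set x *b y | x in U & y in V].

Definition uniformly_open_mul (A : banachAlgType K) : Prop :=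
  forall e : K, 0 < e -> exists2 d : K, 0 < d &
    forall x y : A, ball (x *b y) d `<=` bmul_set (ball x e) (ball y e).

Definition equi_uniformly_open_mul (Gamma : Type)
    (A : Gamma -> banachAlgType K) : Prop :=
  forall e : K, 0 < e -> exists2 d : K, 0 < d &
    forall (g : Gamma) (x y : A g),
      ball (x *b y) d `<=` bmul_set (ball x e) (ball y e).

End UniformlyOpen.

Section BanachAlgebraTheory.
Variables (K : numFieldType) (A : banachAlgType K).
Implicit Types x y : A.

Lemma bmulr0 x : x *b 0 = 0.
Proof. by apply: (addrI (x *b 0)); rewrite -bmulDr !addr0. Qed.

Lemma bmul0r x : 0 *b x = 0.
Proof. by apply: (addrI (0 *b x)); rewrite -bmulDl !addr0. Qed.

Lemma bmulNr x y : (- x) *b y = - (x *b y).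
Proof. by apply: (addrI (x *b y)); rewrite -bmulDl !subrr bmul0r. Qed.

Lemma bmulrN x y : x *b (- y) = - (x *b y).
Proof. by apply: (addrI (x *b y)); rewrite -bmulDr !subrr bmulr0. Qed.

Lemma bmulBl x y z : (x - y) *b z = x *b z - y *b z.
Proof. by rewrite bmulDl bmulNr. Qed.

Lemma bmulBr x y z : x *b (y - z) = x *b y - x *b z.
Proof. by rewrite bmulDr bmulrN. Qed.

End BanachAlgebraTheory.

Section ScalarFieldOrder.
Variables (R : realType) (s : scalar_kind).
Local Notation K := (scalar_field R s).
Implicit Types (S : set K).

Lemma supremums_neq0 S b :
  S !=set0 -> (forall x, S x -> 0 <= x) -> ubound S b -> supremums S !=set0.
Proof.
move: S b; case: s => /= S b S0 Sge Sb.
  have hs : has_sup (S : set R) by split => //; exists b.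
  exists (sup (S : set R)); split; first exact: sup_upper_bound.
  by move=> c Sc; apply: ge_sup.
have h x : S x -> x = (complex.Re x)%:C%C.
  by move=> /Sge; case: x => u v; rewrite lecE /= => /andP[/eqP-> _].
pose T : set R := [set complex.Re x | x in S].
have T0 : T !=set0 by case: S0 => x Sx; exists (complex.Re x), x.
have hs : has_sup T.
  split => //; exists (complex.Re b) => _ [x Sx <-].
  by move: (Sb _ Sx); rewrite lecE => /andP[].
exists (sup T)%:C%C; split=> [x Sx|c Sc].
  rewrite (h _ Sx) lecR; apply: sup_upper_bound => //.
  by exists x.
have cr : c = (complex.Re c)%:C%C.
  case: S0 => x Sx; move: (Sc _ Sx); rewrite (h _ Sx) lecE.
  by case: c {Sc} => u v /= /andP[/eqP-> _].
rewrite cr lecR; apply: ge_sup => // _ [x Sx <-].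
by move: (Sc _ Sx); rewrite lecE => /andP[].
Qed.

Lemma infimums_neq0 S :
  S !=set0 -> (forall x, S x -> 0 <= x) -> infimums S !=set0.
Proof.
move=> [a Sa] Sge.
pose L : set K := [set l | 0 <= l /\ lbound S l].
have L0 : L 0 by split => //; move=> x /Sge.
have Lge x : L x -> 0 <= x by case.
have La : ubound L a by move=> x [_]; apply.
have [c [cub clb]] := supremums_neq0 (ex_intro _ 0 L0) Lge La.
exists c; split=> [x Sx|l lS]; first by apply: clb => y [_]; apply.
have c0 : 0 <= c by exact: cub.
have la : l \is Num.real by rewrite (ler_real (lS _ Sa)) ger0_real ?Sge.
have [l0|/ltW l0] := real_leP (real0 K) la; first by apply: cub.
exact: le_trans l0 c0.
Qed.


Lemma supremum_ub S b x :
  (forall y, S y -> 0 <= y) -> ubound S b -> S x -> x <= supremum 0 S.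
Proof.
move=> Sge Sb Sx; have S0 : S !=set0 by exists x.
rewrite /supremum ifF; last by apply/negbTE/set0P.
have [l lS] := supremums_neq0 S0 Sge Sb.
by have [+ _] := @xgetPex _ 0 (supremums S) (ex_intro _ l lS); apply.
Qed.

Lemma supremum_le S c :
  (forall y, S y -> 0 <= y) -> ubound S c -> 0 <= c -> supremum 0 S <= c.
Proof.
move=> Sge Sc c0; rewrite /supremum; case: ifPn => // /set0P S0.
have [l lS] := supremums_neq0 S0 Sge Sc.
by have [_] := @xgetPex _ 0 (supremums S) (ex_intro _ l lS); apply.
Qed.

Lemma infimum_lb S x :
  (forall y, S y -> 0 <= y) -> S x -> infimum 0 S <= x.
Proof.
move=> Sge Sx; have S0 : S !=set0 by exists x.
rewrite /infimum ifF; last by apply/negbTE/set0P.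
have [l lS] := infimums_neq0 S0 Sge.
by have [+ _] := @xgetPex _ 0 (infimums S) (ex_intro _ l lS); apply.
Qed.

Lemma infimum_ge S c : S !=set0 ->
  (forall y, S y -> 0 <= y) -> lbound S c -> c <= infimum 0 S.
Proof.
move=> S0 Sge Sc; rewrite /infimum ifF; last by apply/negbTE/set0P.
have [l lS] := infimums_neq0 S0 Sge.
by have [_] := @xgetPex _ 0 (infimums S) (ex_intro _ l lS); apply.
Qed.

Lemma exp2V_lt (e : K) : 0 < e -> exists n, 2^-1 ^+ n < e.
Proof.
move=> e0; pose S : set K := range (fun n => 2^-1 ^+ n).
have Sge y : S y -> 0 <= y by move=> [n _ <-]; rewrite exprn_ge0 ?invr_ge0.
have S0 : S !=set0 by exists (2^-1 ^+ 0), 0%N.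
have m0 : 0 <= infimum 0 S by exact: infimum_ge.
have : infimum 0 S *+ 2 <= infimum 0 S.
  apply: infimum_ge => // _ [n _ <-].
  have : infimum 0 S <= 2^-1 ^+ n.+1 by apply: infimum_lb => //; exists n.+1.
  by rewrite exprS ler_pdivlMl ?ltr0n// mulr_natl.
rewrite mulr2n gerDl => mle0.
have {m0 mle0} m0 : infimum 0 S = 0 by apply/eqP; rewrite eq_le m0 mle0.
apply: contrapT => /forallNP h.
suff : e <= infimum 0 S by rewrite m0 => /(lt_le_trans e0); rewrite ltxx.
apply: infimum_ge => // _ [n _ <-].
have en : 2^-1 ^+ n \is @Num.real K.
  by rewrite ger0_real//; apply: Sge; exists n.
by have /negP := h n; rewrite real_ltNge ?negbK// ger0_real ?ltW.
Qed.

End ScalarFieldOrder.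

Section LinftySum.
Variables (R : realType) (s : scalar_kind).
Local Notation K := (scalar_field R s).
Variables (Gamma : Type) (A : Gamma -> banachAlgType K).

Definition bounded_tuple (x : forall g, A g) : Prop :=
  exists M : K, forall g, `|x g| <= M.

Record linfty_sum := LinftySum {
  tuple_of :> forall g, A g;
  tuple_of_bounded : bounded_tuple tuple_of
}.

Lemma linfty_sumP (x y : linfty_sum) : (forall g, x g = y g) -> x = y.
Proof.
case: x y => [x xb] [y yb] /= h.
have xy : x = y by exact: functional_extensionality_dep.
by subst y; congr LinftySum; exact: Prop_irrelevance.
Qed.

HB.instance Definition _ := gen_eqMixin linfty_sum.
HB.instance Definition _ := gen_choiceMixin linfty_sum.

Lemma linfty_zero_bounded : bounded_tuple (fun g => 0 : A g).
Proof. by exists 0 => g; rewrite normr0. Qed.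

Lemma linfty_opp_bounded (x : linfty_sum) : bounded_tuple (fun g => - x g).
Proof. by have [M xM] := tuple_of_bounded x; exists M => g; rewrite normrN. Qed.

Lemma linfty_add_bounded (x y : linfty_sum) :
  bounded_tuple (fun g => x g + y g).
Proof.
have [M xM] := tuple_of_bounded x; have [N yN] := tuple_of_bounded y.
by exists (M + N) => g; rewrite (le_trans (ler_normD _ _))// lerD.
Qed.

Lemma linfty_scale_bounded (a : K) (x : linfty_sum) :
  bounded_tuple (fun g => a *: x g).
Proof.
have [M xM] := tuple_of_bounded x.
by exists (`|a| * M) => g; rewrite normrZ ler_wpM2l ?xM.
Qed.

Lemma linfty_mul_bounded (x y : linfty_sum) :
  bounded_tuple (fun g => x g *b y g).
Proof.
have [M xM] := tuple_of_bounded x; have [N yN] := tuple_of_bounded y.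
by exists (M * N) => g; rewrite (le_trans (normr_bmul _ _))// ler_pM ?xM ?yN.
Qed.

Definition linfty_zero := LinftySum linfty_zero_bounded.
Definition linfty_opp x := LinftySum (linfty_opp_bounded x).
Definition linfty_add x y := LinftySum (linfty_add_bounded x y).
Definition linfty_scale a x := LinftySum (linfty_scale_bounded a x).
Definition linfty_mul x y := LinftySum (linfty_mul_bounded x y).

Lemma linfty_addA : associative linfty_add.
Proof. by move=> x y z; apply: linfty_sumP => g /=; rewrite addrA. Qed.
Lemma linfty_addC : commutative linfty_add.
Proof. by move=> x y; apply: linfty_sumP => g /=; rewrite addrC. Qed.
Lemma linfty_add0 : left_id linfty_zero linfty_add.
Proof. by move=> x; apply: linfty_sumP => g /=; rewrite add0r. Qed.
Lemma linfty_addN : left_inverse linfty_zero linfty_opp linfty_add.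
Proof. by move=> x; apply: linfty_sumP => g /=; rewrite addNr. Qed.

HB.instance Definition _ := GRing.isZmodule.Build linfty_sum
  linfty_addA linfty_addC linfty_add0 linfty_addN.

Lemma linfty_scaleA a b x :
  linfty_scale a (linfty_scale b x) = linfty_scale (a * b) x.
Proof. by apply: linfty_sumP => g /=; rewrite scalerA. Qed.
Lemma linfty_scale1 : left_id 1 linfty_scale.
Proof. by move=> x; apply: linfty_sumP => g /=; rewrite scale1r. Qed.
Lemma linfty_scaleDr : right_distributive linfty_scale +%R.
Proof. by move=> a x y; apply: linfty_sumP => g /=; rewrite scalerDr. Qed.
Lemma linfty_scaleDl x : {morph linfty_scale^~ x : a b / a + b}.
Proof. by move=> a b; apply: linfty_sumP => g /=; rewrite scalerDl. Qed.

HB.instance Definition _ := GRing.Zmodule_isLmodule.Build K linfty_sum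
  linfty_scaleA linfty_scale1 linfty_scaleDr linfty_scaleDl.

(* The supremum is taken in K, whose order for K = R[i] is the partial order
   comparing numbers with the same imaginary part; 0 is the default value, for
   an empty index set. *)
Definition linfty_norm (x : linfty_sum) : K :=
  supremum 0 (range (fun g => `|x g|)).

Lemma norm_range_ge0 (x : linfty_sum) (r : K) :
  range (fun g => `|x g|) r -> 0 <= r.
Proof. by move=> [g _ <-]. Qed.

Lemma norm_le_linfty (x : linfty_sum) g : `|x g| <= linfty_norm x.
Proof.
have [M xM] := tuple_of_bounded x.
apply: (@supremum_ub _ _ _ M) (@norm_range_ge0 x) _ _; last by exists g.
by move=> _ [h _ <-].
Qed.

Lemma linfty_norm_le (x : linfty_sum) c :
  0 <= c -> (forall g, `|x g| <= c) -> linfty_norm x <= c.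
Proof.
move=> c0 xc; apply: supremum_le (@norm_range_ge0 x) _ c0.
by move=> _ [g _ <-].
Qed.

Lemma linfty_norm_ge0 (x : linfty_sum) : 0 <= linfty_norm x.
Proof.
have [[g]|G0] := pselect (inhabited Gamma).
  exact: le_trans (norm_le_linfty x g).
rewrite /linfty_norm /supremum; case: ifPn => // /set0P[_ [g _ _]].
by exfalso; apply: G0.
Qed.

Lemma linfty_normD x y : linfty_norm (x + y) <= linfty_norm x + linfty_norm y.
Proof.
apply: linfty_norm_le => [|g]; first by rewrite addr_ge0 ?linfty_norm_ge0.
by rewrite (le_trans (ler_normD _ _))// lerD// norm_le_linfty.
Qed.

Lemma linfty_normZ (a : K) (x : linfty_sum) :
  linfty_norm (a *: x) = `|a| * linfty_norm x.
Proof.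
apply/eqP; rewrite eq_le; apply/andP; split.
  apply: linfty_norm_le => [|g]; first by rewrite mulr_ge0 ?linfty_norm_ge0.
  by rewrite normrZ; apply: ler_wpM2l => //; exact: norm_le_linfty.
have [->|a0] := eqVneq a 0; first by rewrite normr0 mul0r linfty_norm_ge0.
rewrite -ler_pdivlMl ?normr_gt0//; apply: linfty_norm_le => [|g].
  by rewrite mulr_ge0 ?invr_ge0// linfty_norm_ge0.
by rewrite ler_pdivlMl ?normr_gt0// -normrZ; exact: (norm_le_linfty (a *: x)).
Qed.

Lemma linfty_norm0_eq0 x : linfty_norm x = 0 -> x = 0.
Proof.
move=> x0; apply: linfty_sumP => g /=; apply/eqP.
by rewrite -normr_le0 -x0 norm_le_linfty.
Qed.

HB.instance Definition _ := @Lmodule_isNormed.Build K linfty_sum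
  linfty_norm linfty_normD linfty_normZ linfty_norm0_eq0.

Lemma linfty_normE (x : linfty_sum) :
  `|x| = supremum 0 (range (fun g => `|x g|)).
Proof. by []. Qed.

Lemma norm_tuple_le (x : linfty_sum) g : `|x g| <= `|x|.
Proof. exact: norm_le_linfty. Qed.

Lemma linfty_norm_leP (x : linfty_sum) (c : K) :
  0 <= c -> (forall g, `|x g| <= c) -> `|x| <= c.
Proof. exact: linfty_norm_le. Qed.

Lemma linfty_complete (F : set_system linfty_sum) :
  ProperFilter F -> cauchy F -> cvg F.
Proof.
move=> FF /cauchyP Fball.
have cvg_coord g : cvg ((fun x : linfty_sum => x g) @ F).
  apply: cauchy_cvg; apply/cauchyP => e e0.
  have [x Fx] := Fball e e0; exists (x g).
  suff : F [set y : linfty_sum | ball (x g) e (y g)] by [].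
  apply: filterS Fx => y; rewrite -!ball_normE /=; apply: le_lt_trans.
  exact: (norm_tuple_le (x - y) g).
pose y g : A g := lim ((fun x : linfty_sum => x g) @ F).
have Fy e x : 0 < e -> F (ball x e) -> forall g, `|x g - y g| <= e + e.
  move=> e0 Fx g; have /cvgrPdist_lt/(_ e e0) Fyg := cvg_coord g.
  have [z [zx zy]] := filter_ex (filterI Fx Fyg).
  rewrite (le_trans (ler_distD (z g) _ _))// lerD//; last first.
    by rewrite distrC ltW.
  move: zx; rewrite -ball_normE /= => /ltW; apply: le_trans.
  exact: (norm_tuple_le (x - z) g).
have yb : bounded_tuple y.
  have [x Fx] := Fball 1 ltr01; exists (`|x| + (1 + 1)) => g.
  rewrite -(subrKC (x g) (y g)) (le_trans (ler_normD _ _))//.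
  by rewrite lerD ?norm_tuple_le// distrC; exact: Fy.
apply/cvg_ex; exists (LinftySum yb); apply/cvgrPdist_le => e e0.
have e40 : 0 < e / 4%:R by rewrite divr_gt0.
have [x Fx] := Fball _ e40; apply: filterS (Fx) => z xz.
apply: linfty_norm_leP => [|g /=]; first exact: ltW.
rewrite (le_trans (ler_distD (x g) _ _))//.
have -> : e = (e / 4%:R + e / 4%:R) + (e / 4%:R + e / 4%:R).
  by rewrite -!mulr2n -mulrnA -[RHS]mulr_natr mulfVK// pnatr_eq0.
rewrite lerD//; first by have := Fy _ _ e40 Fx g; rewrite distrC.
rewrite (@le_trans _ _ (e / 4%:R)) ?lerDl ?ltW//.
move: xz; rewrite -ball_normE /=; apply: le_lt_trans.
exact: (norm_tuple_le (x - z) g).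
Qed.

HB.instance Definition _ := Uniform_isComplete.Build linfty_sum linfty_complete.

Lemma linfty_mulA : associative linfty_mul.
Proof. by move=> x y z; apply: linfty_sumP => g /=; rewrite bmulA. Qed.
Lemma linfty_mulDl : left_distributive linfty_mul +%R.
Proof. by move=> x y z; apply: linfty_sumP => g /=; rewrite bmulDl. Qed.
Lemma linfty_mulDr : right_distributive linfty_mul +%R.
Proof. by move=> x y z; apply: linfty_sumP => g /=; rewrite bmulDr. Qed.
Lemma linfty_scaleAl (a : K) (x y : linfty_sum) :
  a *: linfty_mul x y = linfty_mul (a *: x) y.
Proof. by apply: linfty_sumP => g /=; rewrite bscalerAl. Qed.
Lemma linfty_scaleAr (a : K) (x y : linfty_sum) :
  a *: linfty_mul x y = linfty_mul x (a *: y).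
Proof. by apply: linfty_sumP => g /=; rewrite bscalerAr. Qed.
Lemma linfty_normM (x y : linfty_sum) : `|linfty_mul x y| <= `|x| * `|y|.
Proof.
apply: linfty_norm_leP => [|g /=]; first by rewrite mulr_ge0.
by rewrite (le_trans (normr_bmul _ _))// ler_pM// norm_tuple_le.
Qed.

HB.instance Definition _ :=
  CompleteNormedModule_isBanachAlgebra.Build K linfty_sum
    linfty_mulA linfty_mulDl linfty_mulDr linfty_scaleAl linfty_scaleAr
    linfty_normM.

Lemma linfty_bmulE x y g : (x *b y : linfty_sum) g = x g *b y g.
Proof. by []. Qed.

End LinftySum.

Section Ultraproduct.
Variables (R : realType) (s : scalar_kind).
Local Notation K := (scalar_field R s).
Variables (Gamma : Type) (A : Gamma -> banachAlgType K).
Variables (U : set_system Gamma) (HU : UltraFilter U).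
Implicit Types x y : linfty_sum A.

(* The proof that U is an ultrafilter is an argument of the ideal so that the
   structures on the quotient can be inferred. *)
Definition null_ideal (_ : UltraFilter U) : {pred linfty_sum A} :=
  fun x => `[< (fun g => `|x g|) @ U --> (0 : K) >].

Lemma null_idealP x :
  reflect (forall e : K, 0 < e -> \forall g \near U, `|x g| < e)
          (x \in null_ideal HU).
Proof.
apply: (iffP (asboolP _)) => [/cvgrPdist_lt xU e e0|xU].
  by apply: filterS (xU e e0) => g; rewrite sub0r normrN normr_id.
apply/cvgrPdist_lt => e e0.
by apply: filterS (xU e e0) => g; rewrite sub0r normrN normr_id.
Qed.

Lemma null_ideal_closed : zmod_closed (null_ideal HU).
Proof.
split=> [|x y /null_idealP xU /null_idealP yU]; apply/null_idealP => e e0.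
  by near=> g; rewrite normr0.
have e20 : 0 < e / 2%:R by rewrite divr_gt0.
near=> g; rewrite (le_lt_trans (ler_normB _ _))// (splitr e) ltrD//; near: g.
  exact: xU.
exact: yU.
Unshelve. all: by end_near. Qed.

HB.instance Definition _ :=
  GRing.isZmodClosed.Build (linfty_sum A) (null_ideal HU) null_ideal_closed.

Lemma null_idealZ (a : K) x :
  x \in null_ideal HU -> a *: x \in null_ideal HU.
Proof.
move=> /null_idealP xU; apply/null_idealP => e e0.
have a0 : 0 < `|a| + 1 by rewrite ltr_wpDl.
near=> g; rewrite normrZ.
rewrite (@le_lt_trans _ _ ((`|a| + 1) * `|x g|)) ?ler_wpM2r ?lerDl//.
rewrite -ltr_pdivlMl// mulrC; near: g; apply: xU.
by rewrite divr_gt0.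
Unshelve. all: by end_near. Qed.

Lemma null_ideal_dom x y (c : K) : 0 <= c ->
  (forall g, `|y g| <= c * `|x g|) -> x \in null_ideal HU ->
  y \in null_ideal HU.
Proof.
move=> c0 yx /(null_idealZ c)/null_idealP xU; apply/null_idealP => e e0.
near=> g; rewrite (le_lt_trans (yx g))//.
rewrite -[X in X * _]ger0_norm// -normrZ; near: g; exact: xU.
Unshelve. all: by end_near. Qed.

Lemma null_ideal_bmull x y :
  y \in null_ideal HU -> x *b y \in null_ideal HU.
Proof.
apply: (@null_ideal_dom _ _ `|x|) => // g.
by rewrite (le_trans (normr_bmul _ _))// ler_wpM2r// norm_tuple_le.
Qed.

Lemma null_ideal_bmulr x y :
  x \in null_ideal HU -> x *b y \in null_ideal HU.
Proof.
apply: (@null_ideal_dom _ _ `|y|) => // g.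
by rewrite (le_trans (normr_bmul _ _))// mulrC ler_wpM2r// norm_tuple_le.
Qed.

Lemma null_ideal_closed_set : closed [set x | x \in null_ideal HU].
Proof.
move=> x xJ /=; apply/null_idealP => e e0.
have e20 : 0 < e / 2%:R by rewrite divr_gt0.
have [y [/null_idealP yU xy]] := xJ _ (nbhsx_ballx x _ e20).
near=> g; rewrite -(subrK (y g) (x g)) (le_lt_trans (ler_normD _ _))//.
rewrite (splitr e) ltrD//; last by near: g; exact: yU.
move: xy; rewrite -ball_normE /=; apply: le_lt_trans.
exact: (norm_tuple_le (x - y) g).
Unshelve. all: by end_near. Qed.

Local Open Scope quotient_scope.

Definition ultraproduct := Quotient.quot (null_ideal HU).

HB.instance Definition _ := Choice.on ultraproduct.
HB.instance Definition _ := GRing.Zmodule.on ultraproduct.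
HB.instance Definition _ := EqQuotient.on ultraproduct.

Definition ultra_class x : ultraproduct := \pi_ultraproduct x.

Lemma ultra_classK (q : ultraproduct) : ultra_class (repr q) = q.
Proof. exact: reprK. Qed.

Lemma ultra_class_eq x y :
  ultra_class x = ultra_class y <-> x - y \in null_ideal HU.
Proof.
rewrite Quotient.idealrBE; split => [h|/eqP h]; last exact: h.
by apply/eqP; exact: h.
Qed.

Lemma ultra_classD x y : ultra_class (x + y) = ultra_class x + ultra_class y.
Proof. by rewrite /ultra_class !piE. Qed.

Lemma ultra_classB x y : ultra_class (x - y) = ultra_class x - ultra_class y.
Proof. by rewrite /ultra_class !piE. Qed.

Lemma ultra_class0 : ultra_class 0 = 0.
Proof. by rewrite /ultra_class !piE. Qed.

Definition ultra_scale (a : K) (p : ultraproduct) : ultraproduct :=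
  ultra_class (a *: repr p).

Definition ultra_mul (p q : ultraproduct) : ultraproduct :=
  ultra_class (repr p *b repr q).

Lemma ultra_classZ a x : ultra_class (a *: x) = ultra_scale a (ultra_class x).
Proof.
apply/ultra_class_eq; rewrite -scalerBr.
by apply/null_idealZ/ultra_class_eq; rewrite ultra_classK.
Qed.

Lemma ultra_classM x y :
  ultra_class (x *b y) = ultra_mul (ultra_class x) (ultra_class y).
Proof.
apply/ultra_class_eq; rewrite -(subrK (x *b repr (ultra_class y)) (x *b y)) -addrA.
rewrite -bmulBl -bmulBr rpredD//.
  by apply/null_ideal_bmull/ultra_class_eq; rewrite ultra_classK.
by apply/null_ideal_bmulr/ultra_class_eq; rewrite ultra_classK.
Qed.

Lemma ultra_scaleA a b p :
  ultra_scale a (ultra_scale b p) = ultra_scale (a * b) p.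
Proof. by rewrite -[p]ultra_classK -!ultra_classZ scalerA. Qed.
Lemma ultra_scale1 : left_id 1 ultra_scale.
Proof. by move=> p; rewrite -[p]ultra_classK -!ultra_classZ scale1r. Qed.
Lemma ultra_scaleDr : right_distributive ultra_scale +%R.
Proof.
by move=> a p q; rewrite -[p]ultra_classK -[q]ultra_classK -ultra_classD
  -!ultra_classZ scalerDr ultra_classD.
Qed.
Lemma ultra_scaleDl p : {morph ultra_scale^~ p : a b / a + b}.
Proof.
by move=> a b; rewrite -[p]ultra_classK -!ultra_classZ scalerDl ultra_classD.
Qed.

HB.instance Definition _ := GRing.Zmodule_isLmodule.Build K ultraproduct
  ultra_scaleA ultra_scale1 ultra_scaleDr ultra_scaleDl.

Definition ultra_norm (p : ultraproduct) : K :=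
  infimum 0 [set `|x| | x in [set x | ultra_class x = p]].

Lemma ultra_norm_le x : ultra_norm (ultra_class x) <= `|x|.
Proof. by apply: infimum_lb => [_ [y _ <-]//|]; exists x. Qed.

Lemma ultra_norm_ge p c :
  (forall x, ultra_class x = p -> c <= `|x|) -> c <= ultra_norm p.
Proof.
move=> h; apply: infimum_ge.
- by exists `|repr p|, (repr p) => //; exact: ultra_classK.
- by move=> _ [y _ <-].
- by move=> _ [y yp <-]; exact: h.
Qed.

Lemma ultra_norm_ge0 p : 0 <= ultra_norm p.
Proof. by apply: ultra_norm_ge. Qed.

Lemma ultra_norm_lt p c :
  ultra_norm p < c -> exists2 x, ultra_class x = p & `|x| < c.
Proof.
move=> pc; apply: contrapT => h.
have c0 : 0 <= c by rewrite (le_trans (ultra_norm_ge0 p))// ltW.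
suff : c <= ultra_norm p by move=> /(lt_le_trans pc); rewrite ltxx.
apply: ultra_norm_ge => x xp; rewrite real_leNgt ?ger0_real//.
by apply/negP => xc; apply: h; exists x.
Qed.

Lemma ultra_normD p q : ultra_norm (p + q) <= ultra_norm p + ultra_norm q.
Proof.
rewrite -lerBlDr; apply: ultra_norm_ge => x xp.
rewrite lerBlDl -lerBlDr; apply: ultra_norm_ge => y yq.
rewrite lerBlDl -xp -yq -ultra_classD.
exact: le_trans (ultra_norm_le _) (ler_normD _ _).
Qed.

Lemma ultra_normZ_le (a : K) (p : ultraproduct) :
  ultra_norm (a *: p) <= `|a| * ultra_norm p.
Proof.
have [->|a0] := eqVneq a 0.
  rewrite normr0 mul0r scale0r -ultra_class0.
  by rewrite (le_trans (ultra_norm_le 0))// normr0.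
rewrite -ler_pdivrMl ?normr_gt0//; apply: (@ultra_norm_ge p) => x <-.
rewrite ler_pdivrMl ?normr_gt0// -normrZ.
have -> : a *: ultra_class x = ultra_class (a *: x) by rewrite ultra_classZ.
exact: ultra_norm_le.
Qed.

Lemma ultra_normZ (a : K) (p : ultraproduct) :
  ultra_norm (a *: p) = `|a| * ultra_norm p.
Proof.
apply/eqP; rewrite eq_le ultra_normZ_le /=.
have [->|a0] := eqVneq a 0; first by rewrite normr0 mul0r ultra_norm_ge0.
rewrite -ler_pdivlMl ?normr_gt0// -normfV.
by rewrite (le_trans _ (ultra_normZ_le _ _))// scalerA mulVf// scale1r.
Qed.

Lemma ultra_norm0_eq0 p : ultra_norm p = 0 -> p = 0.
Proof.
move=> p0; rewrite -[p]ultra_classK -ultra_class0.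
apply/ultra_class_eq; rewrite subr0.
apply: (@null_ideal_closed_set (repr p)) => B /nbhs_ballP[e /= e0 eB].
have [x xp xe] : exists2 x, ultra_class x = p & `|x| < e.
  by apply: ultra_norm_lt; rewrite p0.
exists (repr p - x); split; first by apply/ultra_class_eq; rewrite ultra_classK.
by apply: eB; rewrite -ball_normE /= opprB addrC subrK.
Qed.

HB.instance Definition _ := @Lmodule_isNormed.Build K ultraproduct
  ultra_norm ultra_normD ultra_normZ ultra_norm0_eq0.

Lemma ultra_normE (p : ultraproduct) :
  `|p| = infimum 0 [set `|x| | x in [set x | ultra_class x = p]].
Proof. by []. Qed.

Lemma norm_ultra_class x : `|ultra_class x| <= `|x|.
Proof. exact: ultra_norm_le. Qed.

Lemma ultra_lift p c : `|p| < c -> exists x, ultra_class x = p /\ `|x| < c.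
Proof. by move=> /ultra_norm_lt[x xp xc]; exists x. Qed.

Lemma ultra_complete (F : set_system ultraproduct) :
  ProperFilter F -> cauchy F -> cvg F.
Proof.
move=> FF /cauchyP Fball.
have h_gt0 n : 0 < 2^-1 ^+ n :> K by rewrite exprn_gt0 ?invr_gt0.
have h4 n : 2^-1 ^+ n <= 2^-1 ^+ n *+ 4 :> K.
  by rewrite [leRHS]mulrS lerDl mulrn_wge0// (ltW (h_gt0 n)).
have [c Fc] := choice (fun n => Fball _ (h_gt0 n)).
have cS n : `|c n.+1 - c n| < 2^-1 ^+ n *+ 2.
  have [q [q1 q2]] := filter_ex (filterI (Fc n.+1) (Fc n)).
  move: q1 q2; rewrite -!ball_normE /= => q1 q2.
  rewrite (le_lt_trans (ler_distD q _ _))// mulr2n ltrD//; last by rewrite distrC.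
  by rewrite (lt_le_trans q1)// exprS ler_piMl ?ltW// invf_lt1// ltr1n.
have [d dP] := choice (fun n => ultra_lift (cS n)).
pose a := fix a n := if n is m.+1 then a m + d m else repr (c 0%N).
have pia n : ultra_class (a n) = c n.
  elim: n => [|n ih] /=; first exact: ultra_classK.
  by rewrite ultra_classD ih (dP n).1 addrC subrK.
have aD n k : `|a (n + k)%N - a n| <= 2^-1 ^+ n *+ 4 - 2^-1 ^+ (n + k) *+ 4.
  elim: k => [|k ih]; first by rewrite addn0 !subrr normr0.
  rewrite addnS /= addrAC (le_trans (ler_normD _ _))//.
  rewrite (le_trans (lerD ih (ltW (dP _).2)))// -addrA lerD2l.
  have -> : 2^-1 ^+ (n + k).+1 *+ 4 = 2^-1 ^+ (n + k) *+ 2 :> K.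
    rewrite -[4%N]/(2 * 2)%N mulrnA exprS -mulrnAl -[X in X * _]mulr_natr.
    by rewrite mulVf ?pnatr_eq0// mul1r.
  by rewrite -[4%N]/(2 + 2)%N mulrnDr opprD addrNK.
have small (e : K) : 0 < e -> exists n, 2^-1 ^+ n *+ 4 < e.
  move=> e0; have [|n ne] := @exp2V_lt R s (e / 4%:R); first by rewrite divr_gt0.
  by exists n; rewrite -[ltLHS]mulr_natr -ltr_pdivlMr.
have aB (n m : nat) : (n <= m)%N -> `|a m - a n| <= 2^-1 ^+ n *+ 4.
  move=> /subnKC <-; rewrite (le_trans (aD _ _))// gerBl.
  by rewrite mulrn_wge0 ?(ltW (h_gt0 _)).
have acvg : cvg (a @ \oo).
  apply: cauchy_cvg; apply/cauchyP => e e0.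
  have [n ne] := small e e0; exists (a n); exists n => // m /= nm.
  rewrite -ball_normE /= distrC; exact: le_lt_trans (aB _ _ nm) ne.
pose l := lim (a @ \oo).
apply/cvg_ex; exists (ultra_class l); apply/cvgrPdist_lt => e e0.
have e20 : 0 < e / 2%:R by rewrite divr_gt0.
have [n ne] := small _ e20.
have /cvgrPdist_lt/(_ _ (h_gt0 n))[N _ Nl] := acvg.
pose m := maxn N n.
have lm : `|l - a m| < 2^-1 ^+ n by apply: Nl => /=; exact: leq_maxl.
have mn : 2^-1 ^+ m <= 2^-1 ^+ n :> K.
  by rewrite ler_wiXn2l ?invr_ge0 ?invf_le1 ?ler1n// leq_maxr.
apply: filterS (Fc m) => q; rewrite -ball_normE /= => qm.
rewrite (le_lt_trans (ler_distD (c m) _ _))// -pia -ultra_classB.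
rewrite (splitr e) ltrD//.
  rewrite (le_lt_trans (norm_ultra_class _))// (lt_trans lm)//.
  exact: le_lt_trans (h4 n) ne.
rewrite pia (lt_trans qm)// (le_lt_trans mn)//.
exact: le_lt_trans (h4 n) ne.
Qed.

HB.instance Definition _ :=
  Uniform_isComplete.Build ultraproduct ultra_complete.

Lemma ultra_mulA : associative ultra_mul.
Proof.
by move=> p q r; rewrite -[p]ultra_classK -[q]ultra_classK -[r]ultra_classK
  -!ultra_classM bmulA.
Qed.
Lemma ultra_mulDl : left_distributive ultra_mul +%R.
Proof.
by move=> p q r; rewrite -[p]ultra_classK -[q]ultra_classK -[r]ultra_classK
  -ultra_classD -!ultra_classM bmulDl ultra_classD.
Qed.
Lemma ultra_mulDr : right_distributive ultra_mul +%R.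
Proof.
by move=> p q r; rewrite -[p]ultra_classK -[q]ultra_classK -[r]ultra_classK
  -ultra_classD -!ultra_classM bmulDr ultra_classD.
Qed.
Lemma ultra_scaleAl (a : K) p q : a *: ultra_mul p q = ultra_mul (a *: p) q.
Proof.
rewrite -[p]ultra_classK -[q]ultra_classK -ultra_classM
  -![a *: _]/(ultra_scale a _) -!ultra_classZ -ultra_classM.
by rewrite bscalerAl.
Qed.
Lemma ultra_scaleAr (a : K) p q : a *: ultra_mul p q = ultra_mul p (a *: q).
Proof.
rewrite -[p]ultra_classK -[q]ultra_classK -ultra_classM
  -![a *: _]/(ultra_scale a _) -!ultra_classZ -ultra_classM.
by rewrite bscalerAr.
Qed.

Lemma ultra_norm_Mge p (c t : K) : 0 <= t ->
  (forall x, ultra_class x = p -> c <= `|x| * t) -> c <= `|p| * t.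
Proof.
rewrite le_eqVlt => /predU1P[<- h|t0 h].
  by have := h _ (ultra_classK p); rewrite !mulr0.
rewrite -ler_pdivrMr//; apply: ultra_norm_ge => x xp.
by rewrite ler_pdivrMr//; exact: h.
Qed.

Lemma ultra_normM (p q : ultraproduct) : `|ultra_mul p q| <= `|p| * `|q|.
Proof.
apply: ultra_norm_Mge => // x <-; rewrite mulrC.
apply: ultra_norm_Mge => // y <-; rewrite mulrC -ultra_classM.
exact: le_trans (norm_ultra_class _) (normr_bmul _ _).
Qed.

HB.instance Definition _ :=
  CompleteNormedModule_isBanachAlgebra.Build K ultraproduct
    ultra_mulA ultra_mulDl ultra_mulDr ultra_scaleAl ultra_scaleAr
    ultra_normM.

Lemma ultra_bmulE x y : ultra_class (x *b y) = ultra_class x *b ultra_class y.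
Proof. exact: ultra_classM. Qed.

Lemma ultra_scalerE (a : K) x : ultra_class (a *: x) = a *: ultra_class x.
Proof. exact: ultra_classZ. Qed.

End Ultraproduct.

(* Main.v *)
(* Lift a small perturbation of a product in the quotient to the l_infty-sum
   with norm still less than delta, factor it coordinatewise by equi-uniform
   openness, and take classes of the bounded factors.  The coordinatewise strict
   bounds only survive in the supremum as non-strict ones, hence the use of
   delta for epsilon / 2. *)
Require Import Defs.
From HB Require Import structures.
From mathcomp Require Import all_boot all_order all_algebra.
From mathcomp Require Import all_classical all_reals all_analysis.

Local Open Scope classical_set_scope.
Local Open Scope ring_scope.

Import Order.TTheory GRing.Theory Num.Theory.
Import numFieldNormedType.Exports.

(** The radius is the same in all coordinates, so [|x| + e] is a common bound; this makes
    coordinatewise chosen factors elements of the sum. *)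
Lemma bounded_tuple_ball {R : realType} {s : scalar_kind} {Gamma : Type}
    {A : Gamma -> banachAlgType (scalar_field R s)} {x : linfty_sum A}
    {u : forall g, A g} {e : scalar_field R s} :
  (forall g, ball (x g) e (u g)) -> bounded_tuple u.
Proof.
move=> xu; exists (`|x| + e) => g; rewrite -(subrKC (x g) (u g)).
rewrite (le_trans (ler_normD _ _))// lerD ?norm_tuple_le// distrC.
by have := xu g; rewrite -ball_normE => /ltW.
Qed.

(** The supremum norm of [x - u] is at most [r], and the quotient map does not increase norms. *)
Lemma ball_ultra_class {R : realType} {s : scalar_kind} {Gamma : Type}
    {A : Gamma -> banachAlgType (scalar_field R s)}
    {U : set_system Gamma} (HU : UltraFilter U) {x u : linfty_sum A}
    {r e : scalar_field R s} :
  0 < r -> r < e -> (forall g, ball (x g) r (u g)) ->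
  ball (ultra_class HU x) e (ultra_class HU u).
Proof.
move=> r0 re xu; rewrite -ball_normE /= -ultra_classB.
rewrite (le_lt_trans (norm_ultra_class _ _))// (le_lt_trans _ re)//.
apply: linfty_norm_leP (ltW r0) _ => g.
by have := xu g; rewrite -ball_normE => /ltW.
Qed.

Theorem corollary3p3 (R : realType) (s : scalar_kind) (Gamma : Type)
    (A : Gamma -> banachAlgType (scalar_field R s))
    (U : set_system Gamma) (HU : UltraFilter U) :
  equi_uniformly_open_mul A -> uniformly_open_mul (ultraproduct A HU).
Proof.
move=> openA e e0.
have e20 : 0 < e / 2%:R by rewrite divr_gt0.
have e2e : e / 2%:R < e by rewrite ltr_pdivrMr// mulr_natr mulr2n ltrDl.
have [d d0 dA] := openA _ e20; exists d => // p q z.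
(* The quotient norm is an infimum over representatives, so [p *b q - z] has a representative [w] of
   norm below [d]. *)
rewrite -ball_normE => /ultra_lift[w [wz wd]].
pose x := repr p; pose y := repr q.
(* Since [|w g| <= |w| < d] for every [g], the factorization is exact in all coordinates, not only
   along [U]. *)
have factor g : exists uv : A g * A g,
    [/\ ball (x g) (e / 2%:R) uv.1, ball (y g) (e / 2%:R) uv.2
      & uv.1 *b uv.2 = x g *b y g - w g].
  have [|u xu [v yv uvE]] := dA g (x g) (y g) (x g *b y g - w g).
    rewrite -ball_normE /= opprB addrC subrK.
    by rewrite (le_lt_trans (norm_tuple_le w g)).
  by exists (u, v).
have {}factor g := cid (factor g).
pose u g := (sval (factor g)).1; pose v g := (sval (factor g)).2.
have xu g : ball (x g) (e / 2%:R) (u g) by have [] := svalP (factor g).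
have yv g : ball (y g) (e / 2%:R) (v g) by have [] := svalP (factor g).
pose u' := LinftySum (bounded_tuple_ball xu).
pose v' := LinftySum (bounded_tuple_ball yv).
exists (ultra_class HU u').
  by rewrite -[p]ultra_classK; exact: (ball_ultra_class HU (u := u') e20 e2e xu).
exists (ultra_class HU v').
  by rewrite -[q]ultra_classK; exact: (ball_ultra_class HU (u := v') e20 e2e yv).
have uvE : u' *b v' = x *b y - w.
  by apply: linfty_sumP => g; have [] := svalP (factor g).
(* The class of [x *b y - w] is [p *b q - (p *b q - z)], that is [z]. *)
rewrite -ultra_bmulE uvE ultra_classB ultra_bmulE !ultra_classK wz.
by rewrite opprB addrC subrK.
Qed.
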